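(* Let $n\geq 2$ and let $A, B, A_3,\ldots,A_n$ be complex Hermitian $n\times n$ matrices, where $A, A_3,\ldots,A_n$ are positive definite and $B$ is arbitrary. Then $$D(A,B,A_3,\ldots,A_n)^2\geq D(A,A,A_3,\ldots,A_n)\cdot D(B,B,A_3,\ldots,A_n),$$ with equality if and only if $B=\lambda A$ for some real number $\lambda$. Moreover, the inequality (without the equality characterization) remains true if $A,A_3,\ldots,A_n$ are only assumed to be positive semi-definite Hermitian and $B$ is an arbitrary Hermitian matrix.
   Context: For complex $n\times n$ matrices $A_r=(a^{(r)}_{ij})_{i,j=1}^n$, $r=1,\ldots,n$, the mixed discriminant is $$D(A_1,\ldots,A_n):=\frac{1}{n!}\sum_{\sigma\in S_n}\det\big(a^{(\sigma(j))}_{ij}\big)_{i,j=1}^n,$$ i.e. in the summand for $\sigma$ the $j$-th column of the determinant is the $j$-th column of $A_{\sigma(j)}$; $S_n$ is the group of permutations of $\{1,\ldots,n\}$. It is symmetric and multilinear in its arguments, and $D(A,\ldots,A)=\det A$. For $n=2$ the list $A_3,\ldots,A_n$ is empty. *)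

(* Defs.v *)
From mathcomp Require Import all_boot all_order all_fingroup all_algebra.
From mathcomp Require Import reals complex.

Set Implicit Arguments.
Unset Strict Implicit.
Unset Printing Implicit Defensive.

Import Order.TTheory GRing.Theory Num.Theory Num.Def.

Local Open Scope ring_scope.
Local Open Scope sesquilinear_scope.

(* With indices starting from 0, [tnth As r] is the (r+1)-st argument. *)
Definition mixed_discriminant (C : numClosedFieldType) (n : nat)
    (As : n.-tuple 'M[C]_n) : C :=
  (n`!%:R)^-1 *
  \sum_(s : 'S_n) \det (\matrix_(i < n, j < n) tnth As (s j) i j).

(* In the order of a [numClosedFieldType], [0 < z] (resp. [0 <= z]) means that
   z is real and positive (resp. nonnegative). *)
Definition positive_definite (C : numClosedFieldType) (n : nat)
    (A : 'M[C]_n) : Prop :=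
  A \is hermsymmx /\
  forall x : 'cV[C]_n, x != 0 -> 0 < (x ^t* *m A *m x) 0 0.

Definition positive_semidefinite (C : numClosedFieldType) (n : nat)
    (A : 'M[C]_n) : Prop :=
  A \is hermsymmx /\
  forall x : 'cV[C]_n, 0 <= (x ^t* *m A *m x) 0 0.

(* Main.v *)
(* Bochner method of Shenfeld and van Handel.  The inequality with its equality
   case says that the quadratic form B |-> D(B, B, A_3, ..., A_n) is negative
   definite on the D-orthogonal complement of A.  This property does not depend
   on the choice of the positive definite A, so for n >= 3 one takes A = A_3
   and, by congruence, A_3 = 1 and B = diag x.  Let a_ij = D(e_i e_i^*, e_j e_j^*, 1,
   A_4, ..., A_n) and let p_i be its row sums.  As D(e_i e_i^*, ...) is, up to a
   factor, a mixed discriminant of minors, the induction hypothesis bounds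
   (a x)_i^2 / p_i below by D(e_i e_i^*, diag x, diag x, A_4, ..., A_n); summing
   over i gives <x, a x> <= sum_i (a x)_i^2 / p_i.  Hence every eigenvalue t of
   diag(p)^-1 a satisfies t <= t^2, and t <= 1 with t = 1 only on constants
   because a has positive off-diagonal entries: all other eigenvalues are
   nonpositive.  The semidefinite case follows by adding e times the identity
   and letting e tend to 0. *)
Require Import Defs.
From mathcomp Require Import all_boot all_order all_fingroup all_algebra.
From mathcomp Require Import reals complex ring.

Set Implicit Arguments.
Unset Strict Implicit.
Unset Printing Implicit Defensive.

Import Order.TTheory GRing.Theory Num.Theory Num.Def.

Local Open Scope ring_scope.
Local Open Scope complex_scope.
Local Open Scope sesquilinear_scope.

(** * Unnormalised mixed discriminants: symmetry, linearity, minors *)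

Section MixedDeterminant.
Variable R : comNzRingType.
Implicit Type n : nat.

(* n! D(A_1, ..., A_n); missing arguments are read as 0, so only lists of size n
   are meaningful. *)
Definition mixdet n (As : seq 'M[R]_n) : R :=
  \sum_(s : 'S_n) \det (\matrix_(i, j) (As`_(s j)) i j).

Lemma mixdet_perm n (As Bs : seq 'M[R]_n) :
  size As = n -> perm_eq As Bs -> mixdet As = mixdet Bs.
Proof.
move=> sA; rewrite perm_sym => pAB.
have sAn : size As == n by apply/eqP.
have/tuple_permP [p Bsp] : perm_eq Bs (Tuple sAn) by [].
rewrite /mixdet Bsp [RHS](reindex_inj (mulIg p^-1%g)) /=.
apply: eq_bigr => s _; congr (\det _); apply/matrixP=> i j; rewrite !mxE.
by rewrite nth_mktuple permM permKV (tnth_nth 0).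
Qed.

(** In the summand of [s] the head of the list supplies exactly one column, the one at [s^-1 ord0],
    and a determinant is linear in each column. *)
Lemma mixdet_linear n a (X Y : 'M[R]_n.+1) Ms :
  mixdet (a *: X + Y :: Ms) = a * mixdet (X :: Ms) + mixdet (Y :: Ms).
Proof.
rewrite /mixdet mulr_sumr -big_split /=; apply: eq_bigr => s _.
have s_neq0 i : s (lift ((s^-1)%g ord0) i) != ord0.
  by rewrite (canF_eq (permK s)) eq_sym neq_lift.
rewrite -[LHS]det_tr.
apply: (@etrans _ _ (a * \det (_)^T + 1 * \det (_)^T)); last first.
  by rewrite mul1r !det_tr.
apply: (determinant_multilinear (i0 := (s^-1)%g ord0)).
- by apply/rowP=> i; rewrite !mxE permKV /= !mxE mul1r.
- by apply/matrixP => i j; rewrite !mxE; move: (s_neq0 i); case: (s _) => -[].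
- by apply/matrixP => i j; rewrite !mxE; move: (s_neq0 i); case: (s _) => -[].
Qed.

Lemma mixdet_swap n (X Y : 'M[R]_n.+2) Ms : size Ms = n ->
  mixdet (X :: Y :: Ms) = mixdet (Y :: X :: Ms).
Proof.
move=> sM; apply: mixdet_perm; first by rewrite /= sM.
by rewrite -[X :: Y :: Ms]/([:: X] ++ [:: Y] ++ Ms) perm_catCA.
Qed.

Lemma mixdet_tr n (As : seq 'M[R]_n) : mixdet (map trmx As) = mixdet As.
Proof.
(* Rows and columns enter this double sum symmetrically, so transposing all matrices merely swaps
   [s] and [t]. *)
have E (B : seq 'M[R]_n) : mixdet B = \sum_(s : 'S_n) \sum_(t : 'S_n)
    (-1) ^+ s * (-1) ^+ t * \prod_(r < n) (B`_r) (s r) (t r).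
  rewrite [RHS]exchange_big /mixdet [LHS](reindex_inj invg_inj) /=.
  apply: eq_bigr => s _.
  rewrite -det_tr /determinant [LHS](reindex_inj (mulgI s^-1%g)) /=.
  apply: eq_bigr => t _; rewrite odd_permM odd_permV signr_addb.
  congr (_ * _); first exact: mulrC.
  rewrite [LHS](reindex_inj (@perm_inj _ s)) /=.
  by apply: eq_bigr => r _; rewrite !mxE permM permK.
rewrite !E exchange_big /=; apply: eq_bigr => s _; apply: eq_bigr => t _.
rewrite [X in X * _]mulrC; congr (_ * _); apply: eq_bigr => r _.
case: (ltnP r (size As)) => h; first by rewrite (nth_map 0) // mxE.
by rewrite !nth_default ?size_map // !mxE.
Qed.

Lemma mixdet_mull n (X : 'M[R]_n) As :
  mixdet (map (mulmx X) As) = \det X * mixdet As.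
Proof.
rewrite /mixdet mulr_sumr; apply: eq_bigr => s _; rewrite -det_mulmx.
congr (\det _); apply/matrixP => i j; rewrite !mxE.
case: (ltnP (s j) (size As)) => h.
  by rewrite (nth_map 0) // mxE; apply: eq_bigr => k _; rewrite mxE.
rewrite nth_default ?size_map // mxE big1 // => k _.
by rewrite mxE nth_default // mxE mulr0.
Qed.

Lemma mixdet_mulr n (X : 'M[R]_n) As :
  mixdet (map (mulmx^~ X) As) = \det X * mixdet As.
Proof.
rewrite -mixdet_tr -map_comp (eq_map (g := mulmx X^T \o trmx)); last first.
  by move=> A /=; rewrite trmx_mul.
by rewrite map_comp mixdet_mull det_tr mixdet_tr.
Qed.

Lemma sum_perm_fix n (i j : 'I_n.+1) (F : 'S_n.+1 -> R) :
  \sum_(s : 'S_n.+1 | s i == j) F s = \sum_(s : 'S_n) F (lift_perm i j s).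
Proof.
(* [f s] is [s] with [i] deleted from the domain and [s i] from the range, which inverts
   [lift_perm]. The default of [odflt] never occurs, as [s] is injective. *)
pose f (s : 'S_n.+1) k := odflt k (unlift (s i) (s (lift i k))).
have fK (s : 'S_n.+1) k : lift (s i) (f s k) = s (lift i k).
  rewrite /f; case: unliftP => [k' ->//|/perm_inj/eqP].
  by rewrite eq_sym (negPf (neq_lift _ _)).
have f_inj (s : 'S_n.+1) : injective (f s).
  by move=> k k' /(congr1 (lift (s i))); rewrite !fK => /perm_inj/lift_inj.
rewrite (reindex_onto (lift_perm i j) (fun s => perm (f_inj s))) /=.
  apply: eq_bigl => s; rewrite lift_perm_id eqxx /=; apply/eqP/permP => k.
  apply: (@lift_inj _ j); rewrite permE -{1}(lift_perm_id i j s) fK.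
  exact: lift_perm_lift.
move=> s /eqP sij; apply/permP => k; case: (unliftP i k) => [k'|] ->.
  by rewrite lift_perm_lift permE -sij fK.
by rewrite lift_perm_id sij.
Qed.

Definition minor_at n (i : 'I_n.+1) (A : 'M[R]_n.+1) := row' i (col' i A).

(** Column [i] is the only nonzero column of [delta_mx i i], so only permutations with [s i = ord0]
    contribute; expanding along that column leaves a minor with sign +1. *)
Lemma mixdet_delta n (i : 'I_n.+1) (Ms : seq 'M[R]_n.+1) :
  mixdet (delta_mx i i :: Ms) = mixdet (map (minor_at i) Ms).
Proof.
rewrite /mixdet (bigID (fun s : 'S_n.+1 => s i == ord0)) /= addrC big1.
  rewrite add0r sum_perm_fix; apply: eq_bigr => s _.
  rewrite (expand_det_col _ i) (bigD1 i) //= big1 => [|k /negPf ki]; last first.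
    by rewrite mxE lift_perm_id mxE ki mul0r.
  rewrite addr0 mxE lift_perm_id mxE !eqxx mul1r /cofactor -signr_odd oddD addbb.
  rewrite mul1r; congr (\det _); apply/matrixP => k l; rewrite !mxE lift_perm_lift /=.
  case: (ltnP (s l) (size Ms)) => h; first by rewrite (nth_map 0) // !mxE.
  by rewrite !nth_default ?size_map // !mxE.
move=> s si; rewrite (expand_det_col _ ((s^-1)%g ord0)) big1 // => k _.
rewrite mxE permKV /= mxE (canF_eq (permKV s)) [ord0 == _]eq_sym (negPf si).
by rewrite andbF mul0r.
Qed.

End MixedDeterminant.

Lemma rmorph_mixdet (R S : comNzRingType) (f : {rmorphism R -> S}) n
    (As : seq 'M[R]_n) : f (mixdet As) = mixdet (map (map_mx f) As).
Proof.
rewrite /mixdet rmorph_sum; apply: eq_bigr => s _; rewrite -det_map_mx.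
congr (\det _); apply/matrixP => i j; rewrite !mxE.
case: (ltnP (s j) (size As)) => h; first by rewrite (nth_map 0) // mxE.
by rewrite !nth_default ?size_map // !mxE rmorph0.
Qed.

Section Multilinearity.
Variable R : comNzRingType.

Lemma mixdet_linear2 n a (X Y Z : 'M[R]_n.+2) Ms : size Ms = n ->
  mixdet (Z :: a *: X + Y :: Ms) =
    a * mixdet (Z :: X :: Ms) + mixdet (Z :: Y :: Ms).
Proof. by move=> sM; rewrite !(mixdet_swap Z) // mixdet_linear. Qed.

Lemma mixdet0 n (Ms : seq 'M[R]_n.+1) : mixdet (0 :: Ms) = 0.
Proof.
by have := mixdet_linear (-1) 0 0 Ms; rewrite scaler0 add0r mulN1r addNr.
Qed.

Lemma mixdetZ n a (X : 'M[R]_n.+1) Ms :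
  mixdet (a *: X :: Ms) = a * mixdet (X :: Ms).
Proof. by rewrite -[a *: X]addr0 mixdet_linear mixdet0 addr0. Qed.

Lemma mixdet_diag n (d : 'rV[R]_n.+1) (Ms : seq 'M[R]_n.+1) :
  mixdet (diag_mx d :: Ms) = \sum_i d 0 i * mixdet (delta_mx i i :: Ms).
Proof.
rewrite diag_mx_sum_delta; elim/big_rec2: _ => [|i x A _ <-].
  exact: mixdet0.
exact: mixdet_linear.
Qed.

Lemma mixdet1 n (Ms : seq 'M[R]_n.+1) :
  mixdet (1%:M :: Ms) = \sum_i mixdet (map (minor_at i) Ms).
Proof.
rewrite -diag_const_mx mixdet_diag; apply: eq_bigr => i _.
by rewrite mxE mul1r mixdet_delta.
Qed.

End Multilinearity.

(** * Congruence, simultaneous diagonalisation and positivity *)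

Section Hermitian.
Variable C : numClosedFieldType.
Implicit Types n m : nat.

Lemma hermsymmxE n (A : 'M[C]_n) : (A \is hermsymmx) = (A^t* == A).
Proof. by rewrite qualifE /= expr0 scale1r eq_sym. Qed.

Lemma trmxC_mul m n p (A : 'M[C]_(m, n)) (B : 'M_(n, p)) :
  (A *m B)^t* = B^t* *m A^t*.
Proof. by rewrite trmx_mul map_mxM. Qed.

(** [X] may be rectangular, so that passing to a principal submatrix is a congruence too, by the
    identity with one row removed. *)
Definition congr_mx n m (X : 'M[C]_(m, n)) (A : 'M_n) : 'M_m := X *m A *m X^t*.

Lemma congr_mx_herm n m (X : 'M[C]_(m, n)) A :
  A \is hermsymmx -> congr_mx X A \is hermsymmx.
Proof.
rewrite !hermsymmxE => /eqP hA.
by rewrite /congr_mx !trmxC_mul trmxCK hA mulmxA.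
Qed.

(** The right inverse [Y] makes [X^t*] injective. Unit matrices and row deletions both have one. *)
Lemma congr_mx_pd n m (X : 'M[C]_(m, n)) Y A :
  X *m Y = 1%:M -> positive_definite A -> positive_definite (congr_mx X A).
Proof.
move=> XY [hA pA]; split=> [|x x0]; first exact: congr_mx_herm.
have -> : x^t* *m congr_mx X A *m x = (X^t* *m x)^t* *m A *m (X^t* *m x).
  by rewrite trmxC_mul trmxCK !mulmxA.
apply: pA; apply: contra x0 => /eqP/(congr1 (mulmx (Y^t*))).
by rewrite mulmx0 mulmxA -trmxC_mul XY trmx1 map_mx1 mul1mx => ->.
Qed.

Lemma herm_diag_real n (A : 'M[C]_n) i : A \is hermsymmx -> A i i \is Num.real.
Proof.
by rewrite hermsymmxE CrealE => /eqP/matrixP/(_ i i); rewrite !mxE => ->.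
Qed.

Lemma pd_diag_gt0 n (A : 'M[C]_n) i : positive_definite A -> 0 < A i i.
Proof.
case=> _ /(_ (delta_mx i 0)).
rewrite trmx_delta map_delta_mx -rowE -colE !mxE; apply.
by apply/eqP => /matrixP/(_ i 0)/eqP; rewrite !mxE !eqxx oner_eq0.
Qed.

Lemma minor_at_congr n (i : 'I_n.+1) (A : 'M[C]_n.+1) :
  minor_at i A = congr_mx (row' i 1%:M) A.
Proof.
apply/matrixP => k l; rewrite !mxE (bigD1 (lift i l)) //= big1 => [|j jl].
  rewrite !mxE eqxx mulr1n conjC1 mulr1 addr0 (bigD1 (lift i k)) //= big1 => [|j jk].
    by rewrite !mxE eqxx mul1r addr0.
  by rewrite !mxE eq_sym (negPf jk) mul0r.
by rewrite !mxE eq_sym (negPf jl) conjC0 mulr0.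
Qed.

Lemma minor_at_pd n (i : 'I_n.+1) (A : 'M[C]_n.+1) :
  positive_definite A -> positive_definite (minor_at i A).
Proof.
rewrite minor_at_congr; apply: (@congr_mx_pd _ _ _ (row' i 1%:M)^T).
apply/matrixP => k l; rewrite !mxE (bigD1 (lift i l)) //= big1 => [|j jl].
  by rewrite !mxE eqxx mulr1 addr0 (inj_eq lift_inj).
by rewrite !mxE [lift i l == _]eq_sym (negPf jl) mulr0.
Qed.

Lemma minor_at_herm n (i : 'I_n.+1) (A : 'M[C]_n.+1) :
  A \is hermsymmx -> minor_at i A \is hermsymmx.
Proof. by rewrite minor_at_congr; apply: congr_mx_herm. Qed.

Lemma herm_diagonalize n (A : 'M[C]_n) : A \is hermsymmx ->
  exists2 U : 'M_n, U *m U^t* = 1%:M & exists d, congr_mx U A = diag_mx d.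
Proof.
move=> hA; have /orthomx_spectralP eA := hermitian_normalmx hA.
have /unitarymxP UU := spectral_unitarymx A.
exists (spectralmx A) => //; exists (spectral_diag A); rewrite /congr_mx {2}eA.
rewrite invmx_unitary ?spectral_unitarymx // !mulmxA UU mul1mx -mulmxA UU.
by rewrite mulmx1.
Qed.

(** A unitary diagonalises [P], inverse square roots rescale it to the identity, and a second
    unitary [V] diagonalises the transformed [A] while fixing the identity. *)
Lemma diagonalize_pencil n (P A : 'M[C]_n) :
  positive_definite P -> A \is hermsymmx ->
  exists2 X : 'M_n, X \in unitmx & congr_mx X P = 1%:M /\
  exists2 d, congr_mx X A = diag_mx d & forall i, d 0 i \is Num.real.
Proof.
move=> pP hA; have [U UU [d Ud]] := herm_diagonalize (proj1 pP).
have d_gt0 i : 0 < d 0 i.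
  have := pd_diag_gt0 i (congr_mx_pd UU pP).
  by rewrite Ud mxE eqxx.
pose E : 'M[C]_n := diag_mx (\row_i (sqrtC (d 0 i))^-1).
pose Y := E *m U.
have EE : E^t* = E.
  rewrite tr_diag_mx map_diag_mx; congr diag_mx; apply/rowP => i.
  by rewrite !mxE; apply/CrealP/ger0_real; rewrite invr_ge0 sqrtC_ge0 ltW.
have YP : congr_mx Y P = 1%:M.
  rewrite /congr_mx trmxC_mul EE mulmxA -!(mulmxA E) mulmxA.
  rewrite -[U *m _ *m _]/(congr_mx U P) Ud !mulmx_diag -diag_const_mx.
  congr diag_mx; apply/rowP => i; rewrite !mxE.
  have s0 : sqrtC (d 0 i) != 0 by rewrite sqrtC_eq0 gt_eqF.
  have := sqrtCK (d 0 i); move: (sqrtC (d 0 i)) s0 => s s0 <-.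
  by rewrite expr2 mulrA mulVf // mul1r mulfV.
have [V VV [e Ve]] := herm_diagonalize (congr_mx_herm Y hA).
have cM B : congr_mx (V *m Y) B = congr_mx V (congr_mx Y B).
  by rewrite /congr_mx trmxC_mul !mulmxA.
have XP : congr_mx (V *m Y) P = 1%:M by rewrite cM YP /congr_mx mulmx1 VV.
exists (V *m Y).
  by have [] := mulmx1_unit (etrans (mulmxA _ _ _) XP).
split=> //; exists e; first by rewrite cM.
move=> i; have := herm_diag_real i (congr_mx_herm (V *m Y) hA).
by rewrite cM Ve mxE eqxx.
Qed.

Lemma mixdet_congr n (X : 'M[C]_n) As :
  mixdet (map (congr_mx X) As) = `|\det X| ^+ 2 * mixdet As.
Proof.
rewrite (eq_map (g := mulmx^~ (X^t*) \o mulmx X)) // map_comp mixdet_mulr.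
by rewrite mixdet_mull det_map_mx det_tr mulrA normCKC.
Qed.

(** Conjugating a Hermitian matrix transposes it, and [mixdet] is invariant under transposition. *)
Lemma mixdet_real n (As : seq 'M[C]_n) :
  (forall A, A \in As -> A \is hermsymmx) -> mixdet As \is Num.real.
Proof.
move=> hAs; rewrite CrealE rmorph_mixdet -mixdet_tr -map_comp.
rewrite (eq_in_map _ id _).1 ?map_id // => A /hAs.
by rewrite hermsymmxE => /eqP {2}<- /=; rewrite map_trmx.
Qed.

(** Induction on the size: a congruence turns the first argument into the identity, and the value
    becomes a sum over principal minors of the other, still positive definite, arguments. *)
Lemma mixdet_gt0 n (As : seq 'M[C]_n) : size As = n ->
  (forall A, A \in As -> positive_definite A) -> 0 < mixdet As.
Proof.
elim: n As => [|n IH] [|A As] //=.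
  move=> _ _; rewrite /mixdet (eq_bigr (fun=> 1)) => [|s _].
    by rewrite sumr_const card_Sn ltr01.
  exact: det_mx00.
move=> [sAs] pAs; have pA := pAs _ (mem_head A As).
have [X Xu [XA _]] := diagonalize_pencil pA (proj1 pA).
have X_gt0 : 0 < `|\det X| ^+ 2.
  by rewrite exprn_gt0 // normr_gt0 -unitfE -unitmxE.
rewrite -(pmulr_rgt0 _ X_gt0) -mixdet_congr /= XA mixdet1.
have minors_gt0 i : 0 < mixdet (map (minor_at i) (map (congr_mx X) As)).
  apply: IH; first by rewrite !size_map.
  move=> _ /mapP [_ /mapP [B BAs ->] ->]; apply/minor_at_pd.
  by apply: (congr_mx_pd (mulmxV Xu)); apply: pAs; rewrite inE BAs orbT.
rewrite (bigD1 ord0) //= ltr_wpDr //; apply: sumr_ge0 => i _; exact: ltW.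
Qed.

End Hermitian.

(** * Spectrum of a symmetric nonnegative matrix under a Bochner-type bound *)

Section PerronBochner.
Variables (C : numClosedFieldType) (n : nat).
Implicit Types (p x z : 'rV[C]_n) (a : 'M[C]_n).

(** Passes from real vectors, where the Bochner bound is given, to the complex eigenvectors found
    below: for z = x + iy the cross terms cancel by symmetry of [a]. *)
Lemma real_form_ge0 a : a^T = a -> (forall i j, a i j \is Num.real) ->
  (forall x, (forall i, x 0 i \is Num.real) -> 0 <= (x *m a *m x^T) 0 0) ->
  forall z, 0 <= (z *m a *m z^t*) 0 0.
Proof.
move=> sa ra pa z; pose x := map_mx (@Re C) z; pose y := map_mx (@Im C) z.
have zE : z = x + 'i *: y by apply/rowP => i; rewrite !mxE -Crect.
have zC : z^t* = x^T - 'i *: y^T.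
  by apply/colP => i; rewrite !mxE -conjC_rect ?Creal_Re ?Creal_Im // -Crect.
have xy : x *m a *m y^T = y *m a *m x^T.
  have <- : (x *m a *m y^T)^T = y *m a *m x^T.
    by rewrite !trmx_mul trmxK sa mulmxA.
  by apply/matrixP => i j; rewrite !ord1 [RHS]mxE.
rewrite zC zE !mulmxDl !mulmxBr -!scalemxAl -!scalemxAr xy.
rewrite addrA subrK scalerA -expr2 sqrCi scaleN1r opprK mxE.
by apply: addr_ge0; apply: pa => i; rewrite mxE ?Creal_Re ?Creal_Im.
Qed.

(** [diag_mx p - a] is the Laplacian of the graph with edge weights [a i j]; the factor 2 counts
    every edge from both ends. *)
Lemma laplacian_form a p z :
  (forall i, p 0 i = \sum_j a i j) -> a^T = a ->
  2 * (z *m (diag_mx p - a) *m z^t*) 0 0 =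
  \sum_i \sum_j a i j * `|z 0 i - z 0 j| ^+ 2.
Proof.
move=> pE sa.
have aC i j : a i j = a j i by rewrite -{1}sa mxE.
have E : (z *m (diag_mx p - a) *m z^t*) 0 0 =
  \sum_i \sum_j a i j * (`|z 0 i| ^+ 2 - z 0 j * (z 0 i)^*).
  rewrite mulmxBr mul_mx_diag mxE; apply: eq_bigr => i _; rewrite !mxE.
  rewrite pE mulrBl mulr_sumr !mulr_suml -sumrB; apply: eq_bigr => j _.
  by rewrite normCK (aC j i) mulrBr !mulrA ![a i j * _]mulrC.
have E' := E; rewrite exchange_big /= in E'.
rewrite mulr2n mulrDl mul1r {1}E' E -big_split /=.
apply: eq_bigr => i _; rewrite -big_split; apply: eq_bigr => j _ /=.
rewrite (aC j i) !normCK rmorphB /=.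
have ringE (b u v u' v' : C) : b * (v * v' - u * v') + b * (u * u' - v * u') =
    b * ((u - v) * (u' - v')) by ring.
exact: ringE.
Qed.

(** The rows of the diagonalising [X] are eigenvectors of the pencil ([a], [diag_mx p]), with
    eigenvalues [d]. A positive eigenvalue must be 1 with a constant eigenvector, and [x] is
    orthogonal to constants for the weight [p]. *)
Lemma perron_bochner a p :
  (forall i, p 0 i = \sum_j a i j) -> a^T = a ->
  (forall i j, 0 <= a i j) -> (forall i j, i != j -> 0 < a i j) ->
  (forall i, 0 < p 0 i) ->
  (forall x, (forall i, x 0 i \is Num.real) ->
     (x *m a *m x^T) 0 0 <= \sum_i (x *m a) 0 i ^+ 2 / p 0 i) ->
  forall x, \sum_i x 0 i * p 0 i = 0 ->
    (x *m a *m x^t*) 0 0 <= 0 /\ ((x *m a *m x^t*) 0 0 = 0 -> x *m a = 0).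
Proof.
move=> pE sa a_ge0 a_gt0 p_gt0 hB x xp.
have a_real i j : a i j \is Num.real by apply/ger0_real.
have aC : a^t* = a.
  by rewrite sa; apply/matrixP => i j; rewrite mxE; apply/CrealP.
have pP : positive_definite (diag_mx p).
  split=> [|z z0].
    rewrite hermsymmxE tr_diag_mx map_diag_mx; apply/eqP; congr diag_mx.
    by apply/rowP => i; rewrite mxE; apply/CrealP/gtr0_real.
  have E : (z^t* *m diag_mx p *m z) 0 0 = \sum_i p 0 i * `|z i 0| ^+ 2.
    rewrite mul_mx_diag mxE; apply: eq_bigr => i _; rewrite mxE normCKC mulrA.
    by rewrite [p 0 i * _]mulrC !mxE.
  have ge0 i : 0 <= p 0 i * `|z i 0| ^+ 2.
    by rewrite mulr_ge0 ?exprn_ge0 // ltW.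
  rewrite E lt_def sumr_ge0 // andbT; apply: contra z0.
  rewrite psumr_eq0 // => /allP z0; apply/eqP/colP => i; rewrite mxE.
  have := z0 i (mem_index_enum i); rewrite mulf_eq0 gt_eqF //=.
  by rewrite expf_eq0 normr_eq0 => /eqP.
have ha : a \is hermsymmx by rewrite hermsymmxE aC.
have [X Xu [XP [d Xa d_real]]] := diagonalize_pencil pP ha.
have PX : diag_mx p *m X^t* *m X = 1%:M.
  by apply: mulmx1C; rewrite mulmxA.
(* Pi = diag(p)^-1 *)
have [Pi PiD] : exists Pi, Pi = X^t* *m X by exists (X^t* *m X).
have PiE : Pi = diag_mx (\row_i (p 0 i)^-1).
  rewrite PiD -[RHS]mulmx1 -PX !mulmxA mulmx_diag.
  rewrite (_ : \row_i _ = const_mx 1) ?diag_const_mx ?mul1mx //.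
  by apply/rowP => i; rewrite !mxE mulVf // gt_eqF.
have XaX : X *m a *m Pi *m a *m X^t* = diag_mx d *m diag_mx d.
  by rewrite -Xa /congr_mx PiD !mulmxA.
have rowE k M : (row k X *m M *m (row k X)^t*) 0 0 = congr_mx X M k k.
  rewrite -row_mul /congr_mx !mxE; apply: eq_bigr => j _; rewrite [in LHS]mxE.
  by congr (_ * _); rewrite !mxE.
(* By [hB] the form of [a *m Pi *m a - a] is nonnegative on real vectors; on row [k] of [X] it
   equals d_k^2 - d_k. *)
have d_sqr k : d 0 k <= d 0 k ^+ 2.
  have := @real_form_ge0 (a *m Pi *m a - a) _ _ _ (row k X).
  rewrite rowE /congr_mx mulmxBr mulmxBl !mulmxA XaX -/(congr_mx X a) Xa.
  rewrite mulmx_diag !mxE eqxx !mulr1n subr_ge0 -expr2; apply.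
  - by rewrite linearB /= !trmx_mul sa PiE tr_diag_mx mulmxA.
  - move=> i j; rewrite PiE !mxE; apply: rpredB => //; apply: rpred_sum => l _.
    by rewrite mul_mx_diag !mxE; apply: rpredM => //; apply: rpredM => //;
      rewrite rpredV; exact/gtr0_real.
  move=> y y_real; rewrite mulmxBr mulmxBl mxE [X in _ + X]mxE subr_ge0.
  apply: le_trans (hB y y_real) _; rewrite !mulmxA -(mulmxA (y *m a *m Pi)).
  have -> : a *m y^T = (y *m a)^T by rewrite trmx_mul sa.
  rewrite PiE mul_mx_diag [leRHS]mxE ler_sum // => i _.
  rewrite [(_^T) _ _]mxE [(\matrix_(_, _) _) _ _]mxE [(\row__ _) _ _]mxE.
  by rewrite expr2 mulrAC.
have lap_ge0 k i j : 0 <= a i j * `|row k X 0 i - row k X 0 j| ^+ 2.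
  by rewrite mulr_ge0 // exprn_ge0.
have d_lap k := laplacian_form (row k X) pE sa.
(* The Laplacian form takes the value 1 - d_k on row [k] of [X]. *)
have d_le1 k : d 0 k <= 1.
  move: (d_lap k); rewrite rowE /congr_mx mulmxBr mulmxBl -!/(congr_mx _ _).
  rewrite XP Xa !mxE eqxx !mulr1n => E; rewrite -subr_ge0.
  rewrite -(pmulr_rge0 _ (ltr0n C 2)) E.
  by apply: sumr_ge0 => i _; apply: sumr_ge0.
(* Now the Laplacian form vanishes on row [k]; since all off-diagonal weights are positive, the row
   is constant. *)
have d_1 k : d 0 k = 1 -> forall i, X k i = X k k.
  move=> dk; move: (d_lap k); rewrite rowE /congr_mx mulmxBr mulmxBl.
  rewrite -!/(congr_mx _ _) XP Xa !mxE eqxx dk subrr mulr0 => /esym/eqP.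
  rewrite psumr_eq0 => [/allP E i|i _]; last exact: sumr_ge0.
  have := E i (mem_index_enum i); rewrite psumr_eq0 // => /allP/(_ k).
  move=> /(_ (mem_index_enum k)); rewrite mulf_eq0 expf_eq0 normr_eq0 subr_eq0.
  case: (eqVneq i k) => [->//|ik]; rewrite gt_eqF ?a_gt0 //= !mxE.
  by move=> /eqP.
(* [w] holds the coordinates of [x] in the eigenbasis; the form of [a] at [x] is the sum of d_k
   |w_k|^2. *)
pose w := x *m invmx X.
have xw : x = w *m X by rewrite mulmxKV.
have wE : w = x *m diag_mx p *m X^t*.
  by rewrite {1}xw -!mulmxA (mulmxA X) -/(congr_mx X _) XP mulmx1.
clearbody w.
have d_w k : d 0 k * `|w 0 k| ^+ 2 <= 0.
  have w_ge0 : 0 <= `|w 0 k| ^+ 2 by rewrite exprn_ge0.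
  have [d_le0|d_gt0] := real_leP (d_real k) (real0 _); first exact: mulr_le0_ge0.
  have dk : d 0 k = 1.
    apply/le_anti; rewrite d_le1 /=.
    by have := d_sqr k; rewrite expr2 -{1}[d 0 k]mulr1 ler_pM2l.
  rewrite dk mul1r wE mul_mx_diag mxE.
  rewrite (eq_bigr (fun i => x 0 i * p 0 i * (X k k)^*)) => [|i _].
    by rewrite -mulr_suml xp mul0r normr0 expr2 mulr0.
  by rewrite !mxE d_1.
have E : (x *m a *m x^t*) 0 0 = \sum_k d 0 k * `|w 0 k| ^+ 2.
  rewrite xw trmxC_mul mulmxA -(mulmxA w) -(mulmxA w) -/(congr_mx X a) Xa.
  rewrite mul_mx_diag mxE; apply: eq_bigr => k _.
  by rewrite !mxE normCK mulrAC mulrC.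
rewrite E; split; first by apply: sumr_le0.
move=> /eqP; rewrite -oppr_eq0 -sumrN psumr_eq0 => [/allP dw|k _]; last first.
  by rewrite oppr_ge0.
have wD : w *m diag_mx d = 0.
  apply/rowP => k; rewrite mul_mx_diag !mxE mulrC.
  have := dw k (mem_index_enum k).
  rewrite oppr_eq0 !mulf_eq0 orbb normr_eq0.
  by move=> /orP[]/eqP->; rewrite ?mul0r ?mulr0.
have XCu : X^t* \in unitmx.
  by rewrite unitmxE det_map_mx det_tr unitfE conjC_eq0 -unitfE -unitmxE.
rewrite -[x *m a](mulmxK XCu) xw -!mulmxA (mulmxA X) (mulmxA _ (X^t*)).
by rewrite -/(congr_mx X a) Xa mulmxA wD mul0mx.
Qed.

End PerronBochner.

(** * Lorentzian forms: reduction, reverse Cauchy-Schwarz, change of base point *)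

Section Lorentzian.
Variable C : numClosedFieldType.
Implicit Types n m : nat.

(** Negative definiteness on the orthogonal complement of [A]. If the form is also positive at [A],
    its signature on Hermitian matrices is (+, -, ..., -). *)
Definition lorentzian_at n (Ms : seq 'M[C]_n) (A : 'M_n) :=
  forall B, B \is hermsymmx -> mixdet [:: A, B & Ms] = 0 ->
  mixdet [:: B, B & Ms] <= 0 /\ (mixdet [:: B, B & Ms] = 0 -> B = 0).

Lemma congr_mx_eq0 n (X A : 'M[C]_n) :
  X \in unitmx -> congr_mx X A = 0 -> A = 0.
Proof.
move=> Xu /(congr1 (congr_mx (invmx X))).
have cI B : congr_mx (invmx X) B = invmx X *m B *m (invmx X)^t* by [].
have XXC : X^t* *m (invmx X)^t* = 1%:M.
  by rewrite -trmxC_mul mulVmx // trmx1 map_mx1.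
rewrite [in X in _ = X -> _]cI mulmx0 mul0mx => <-.
by rewrite /congr_mx !mulmxA mulVmx // mul1mx -mulmxA XXC mulmx1.
Qed.

(** A congruence multiplies all values by |det X|^2 > 0, so signs and zeros survive when [A] becomes
    the identity and [B] diagonal. *)
Lemma lorentzian_reduce n (Ms : seq 'M[C]_n) A :
  positive_definite A ->
  (forall X, X \in unitmx -> congr_mx X A = 1%:M ->
   forall d : 'rV_n, (forall i, d 0 i \is Num.real) ->
   let Ns := map (congr_mx X) Ms in
   mixdet [:: 1%:M, diag_mx d & Ns] = 0 ->
   mixdet [:: diag_mx d, diag_mx d & Ns] <= 0 /\
   (mixdet [:: diag_mx d, diag_mx d & Ns] = 0 -> d = 0)) ->
  lorentzian_at Ms A.
Proof.
move=> pA H B hB AB.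
have [X Xu [XA [d Xd d_real]]] := diagonalize_pencil pA hB.
have X_gt0 : 0 < `|\det X| ^+ 2.
  by rewrite exprn_gt0 // normr_gt0 -unitfE -unitmxE.
have E Y Z : mixdet [:: congr_mx X Y, congr_mx X Z & map (congr_mx X) Ms] =
    `|\det X| ^+ 2 * mixdet [:: Y, Z & Ms].
  by rewrite -mixdet_congr.
have /= := H X Xu XA d d_real; rewrite -XA -Xd !E AB mulr0 => -[//|le0 eq0].
split; first by rewrite -(pmulr_rle0 _ X_gt0).
move=> BB; apply: (congr_mx_eq0 Xu); rewrite Xd eq0 ?BB ?mulr0 //.
by apply/matrixP => i j; rewrite !mxE mul0rn.
Qed.

Lemma herm_linear n (t : C) (A B : 'M_n) : t \is Num.real ->
  A \is hermsymmx -> B \is hermsymmx -> t *: A + B \is hermsymmx.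
Proof.
rewrite !hermsymmxE CrealE => /eqP tr /eqP hA /eqP hB.
apply/eqP; rewrite -{2}hA -{2}hB; apply/matrixP => i j.
by rewrite !mxE rmorphD rmorphM /= tr.
Qed.

Section Form.
Variables (m : nat) (Ms : seq 'M[C]_m.+2).
Hypotheses (sM : size Ms = m)
  (hM : forall M, M \in Ms -> M \is hermsymmx).
Implicit Types A B Z : 'M[C]_m.+2.

Lemma herm_form_real A B : A \is hermsymmx -> B \is hermsymmx ->
  mixdet [:: A, B & Ms] \is Num.real.
Proof.
move=> hA hB; apply: mixdet_real => M.
by rewrite !inE => /or3P [/eqP->|/eqP->|/hM].
Qed.

Lemma form_shift A B t : mixdet [:: t *: A + B, t *: A + B & Ms] =
  t ^+ 2 * mixdet [:: A, A & Ms] + 2 * t * mixdet [:: A, B & Ms] +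
  mixdet [:: B, B & Ms].
Proof.
by rewrite mixdet_linear !mixdet_linear2 // (mixdet_swap B A) //; ring.
Qed.

(** The shift [t] makes [t *: A + B] orthogonal to [A]; negativity of the form there is the
    inequality, and definiteness gives the equality case. *)
Lemma lorentzian_cauchy_schwarz A B :
  lorentzian_at Ms A -> A \is hermsymmx -> 0 < mixdet [:: A, A & Ms] ->
  B \is hermsymmx ->
  mixdet [:: A, A & Ms] * mixdet [:: B, B & Ms] <= mixdet [:: A, B & Ms] ^+ 2 /\
  (mixdet [:: A, B & Ms] ^+ 2 = mixdet [:: A, A & Ms] * mixdet [:: B, B & Ms] ->
   exists2 t, t \is Num.real & B = t *: A).
Proof.
move=> LA hA AA hB; set q := mixdet [:: A, A & Ms] in AA *.
set r := mixdet [:: A, B & Ms]; have q0 : q != 0 by rewrite gt_eqF.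
have r_real : r \is Num.real by apply: herm_form_real.
pose t := - (r / q).
have t_real : t \is Num.real by rewrite rpredN rpredM // rpredV gtr0_real.
have [|le0 eq0] := LA _ (herm_linear t_real hA hB).
  by rewrite mixdet_linear2 // -/q -/r /t mulNr divfK // addNr.
have E : q * mixdet [:: t *: A + B, t *: A + B & Ms] =
    q * mixdet [:: B, B & Ms] - r ^+ 2.
  by rewrite form_shift -/q -/r /t; field.
split; first by rewrite -subr_le0 -E pmulr_rle0.
move=> req; exists (r / q); first by rewrite -[r / q]opprK rpredN.
apply/eqP; rewrite -subr_eq0 addrC -scaleNr; apply/eqP/eq0.
by apply: (mulfI q0); rewrite E req subrr mulr0.
Qed.

(** For [B] orthogonal to [A], choose [t] with [t *: A + B] orthogonal to [Z]. The form there is t^2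
    q plus its value at [B], and t^2 q is nonnegative. *)
Lemma lorentzian_transfer Z A :
  lorentzian_at Ms Z -> A \is hermsymmx -> Z \is hermsymmx ->
  0 < mixdet [:: Z, A & Ms] -> 0 < mixdet [:: A, A & Ms] ->
  lorentzian_at Ms A.
Proof.
move=> LZ hA hZ ZA AA B hB AB; set q := mixdet [:: A, A & Ms] in AA.
have ZB_real := herm_form_real hZ hB.
pose t := - (mixdet [:: Z, B & Ms] / mixdet [:: Z, A & Ms]).
have t_real : t \is Num.real by rewrite rpredN rpredM // rpredV gtr0_real.
have [|] := LZ _ (herm_linear t_real hA hB).
  by rewrite mixdet_linear2 // /t mulNr divfK ?gt_eqF // addNr.
rewrite form_shift AB mulr0 addr0 -/q => le0 eq0.
have tq : 0 <= t ^+ 2 * q by apply: mulr_ge0 (ltW AA); apply: real_exprn_even_ge0.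
split; first by apply: le_trans le0; rewrite lerDr.
move=> BB; rewrite BB addr0 in le0 eq0.
have tq0 : t ^+ 2 * q = 0 by apply/le_anti; rewrite le0.
have t0 : t = 0.
  by move/eqP: tq0; rewrite mulf_eq0 expf_eq0 [q == 0]gt_eqF // orbF => /eqP.
by have := eq0 tq0; rewrite t0 scale0r add0r.
Qed.

End Form.

End Lorentzian.

(** * Lorentzian property of mixed discriminants, by induction on the size *)

Section MixdetLorentzian.
Variable C : numClosedFieldType.
Implicit Types n m : nat.

Lemma positive_definite1 n : positive_definite (1%:M : 'M[C]_n).
Proof.
split=> [|x x0]; first by rewrite hermsymmxE trmx1 map_mx1.
rewrite mulmx1 mxE lt_def sumr_ge0 => [|i _]; last first.
  by rewrite !mxE mulrC mul_conjC_ge0.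
rewrite andbT; apply: contra x0; rewrite psumr_eq0 => [/allP x0|i _]; last first.
  by rewrite !mxE mulrC mul_conjC_ge0.
apply/eqP/colP => i; have := x0 i (mem_index_enum i).
by rewrite !mxE mulrC mul_conjC_eq0 => /eqP.
Qed.

Lemma diag_mx_herm n (d : 'rV[C]_n) :
  (forall i, d 0 i \is Num.real) -> diag_mx d \is hermsymmx.
Proof.
move=> d_real; rewrite hermsymmxE tr_diag_mx map_diag_mx; apply/eqP.
by congr diag_mx; apply/rowP => i; rewrite mxE; apply/CrealP.
Qed.

Lemma delta_mx_herm n (i : 'I_n) : (delta_mx i i : 'M[C]_n) \is hermsymmx.
Proof. by rewrite hermsymmxE trmx_delta map_delta_mx. Qed.

Lemma minor_at1 n (i : 'I_n.+1) : minor_at i (1%:M : 'M[C]_n.+1) = 1%:M.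
Proof. by apply/matrixP => k l; rewrite !mxE (inj_eq lift_inj). Qed.

(** After reduction the diagonal entries are opposite, so the form, twice their product, is minus
    twice a square. *)
Lemma lorentzian_mx2 (A : 'M[C]_2) :
  positive_definite A -> lorentzian_at [::] A.
Proof.
move=> pA; apply: (lorentzian_reduce pA) => X _ _ d d_real /=.
rewrite mixdet1 mixdet_diag !big_ord_recl !big_ord0 !mixdet_delta /= !addr0.
have m1 (M : 'M[C]_1) : mixdet [:: M] = M 0 0.
  rewrite /mixdet (eq_bigr (fun=> M 0 0)) => [|s _].
    by rewrite sumr_const card_Sn.
  by rewrite det_mx11 mxE (ord1 (s 0)).
rewrite !m1 !mxE !eqxx !mulr1n.
set u := lift ord0 ord0; rewrite (_ : lift u 0 = ord0); last exact/val_inj.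
move=> /eqP; rewrite addr_eq0 => /eqP du; rewrite du.
rewrite mulNr mulrN -opprD -mulr2n oppr_le0; split.
  by rewrite mulrn_wge0 // -expr2 real_exprn_even_ge0.
move=> /eqP; rewrite oppr_eq0 mulrn_eq0 /= mulf_eq0 orbb => /eqP d0.
apply/rowP => i; rewrite mxE; case: (unliftP ord0 i) => [j|] ->.
  by rewrite (ord1 j) -/u du d0 oppr0.
exact: d0.
Qed.

Section Step.
Variable m : nat.
Hypothesis IH : forall Ms : seq 'M[C]_m.+2, size Ms = m ->
  (forall M, M \in Ms -> positive_definite M) ->
  forall A, positive_definite A -> lorentzian_at Ms A.

Variable Ns : seq 'M[C]_m.+3.
Hypotheses (sN : size Ns = m)
  (pN : forall M, M \in Ns -> positive_definite M).

Let Ns' i := map (minor_at i) Ns.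

Let sN' i : size (Ns' i) = m. Proof. by rewrite size_map. Qed.

Let pN' i M : M \in Ns' i -> positive_definite M.
Proof. by move=> /mapP [N NNs ->]; apply/minor_at_pd/pN. Qed.

Let q (X Y : 'M[C]_m.+3) := mixdet [:: X, Y, 1%:M & Ns].

Let a : 'M[C]_m.+3 := \matrix_(i, j) q (delta_mx i i) (delta_mx j j).

Let p : 'rV[C]_m.+3 := \row_i \sum_j a i j.

Let qC X Y : q X Y = q Y X.
Proof. by rewrite /q mixdet_swap //= sN. Qed.

Let q_diagl d Y : q (diag_mx d) Y = \sum_i d 0 i * q (delta_mx i i) Y.
Proof. exact: mixdet_diag. Qed.

Let q_delta i d : q (delta_mx i i) (diag_mx d) = (d *m a) 0 i.
Proof.
rewrite qC q_diagl mxE; apply: eq_bigr => j _; by rewrite mxE.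
Qed.

Let q_diag c d : q (diag_mx c) (diag_mx d) = (c *m a *m d^T) 0 0.
Proof.
rewrite qC q_diagl mxE; apply: eq_bigr => i _.
by rewrite q_delta [d^T _ _]mxE mulrC.
Qed.

(** The identity kept as third argument restricts to the identity of the minor, so row [i] of the
    form is a pairing with the identity one size lower, within reach of [IH]. *)
Let q_minor i Y : q (delta_mx i i) Y = mixdet [:: 1%:M, minor_at i Y & Ns' i].
Proof. by rewrite /q mixdet_delta /= minor_at1 mixdet_swap ?size_map. Qed.

Let pE i : p 0 i = mixdet [:: 1%:M, 1%:M & Ns' i].
Proof.
rewrite -{2}(minor_at1 i) -q_minor -diag_const_mx q_delta mxE [RHS]mxE.
apply: eq_bigr => j _; rewrite [const_mx _ _ _]mxE mul1r.
by rewrite !mxE qC.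
Qed.

Let q_minors d :
  q (diag_mx d) (diag_mx d) =
  \sum_i mixdet [:: minor_at i (diag_mx d), minor_at i (diag_mx d) & Ns' i].
Proof.
rewrite /q -(mixdet1 [:: diag_mx d, diag_mx d & Ns]).
apply: mixdet_perm; first by rewrite /= sN.
by rewrite -[_ :: _]/([:: _; _] ++ [:: _] ++ _) perm_catCA.
Qed.

Lemma lorentzian_diag (d : 'rV_m.+3) : (forall i, d 0 i \is Num.real) ->
  mixdet [:: 1%:M, diag_mx d, 1%:M & Ns] = 0 ->
  mixdet [:: diag_mx d, diag_mx d, 1%:M & Ns] <= 0 /\
  (mixdet [:: diag_mx d, diag_mx d, 1%:M & Ns] = 0 -> d = 0).
Proof.
rewrite -!/(q _ _) => d_real d1.
have sa : a^T = a by apply/matrixP => i j; rewrite !mxE qC.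
have a_gt0 i j : i != j -> 0 < a i j.
  rewrite mxE /q mixdet_delta /=.
  case: (unliftP i j) => [k|] ->; last by rewrite eqxx.
  have -> : minor_at i (delta_mx (lift i k) (lift i k) : 'M[C]__) = delta_mx k k.
    by apply/matrixP => x y; rewrite !mxE !(inj_eq lift_inj).
  rewrite mixdet_delta => _; apply: mixdet_gt0; first by rewrite /= !size_map sN.
  rewrite /= !minor_at1 => M; rewrite inE => /orP[/eqP->|].
    exact: positive_definite1.
  by move=> /mapP [N /pN' pNi ->]; apply: minor_at_pd.
have a_ge0 i j : 0 <= a i j.
  case: (eqVneq i j) => [<-|/a_gt0/ltW//]; rewrite mxE /q mixdet_delta /=.
  rewrite (_ : minor_at i _ = 0) ?mixdet0 //.
  by apply/matrixP => x y; rewrite !mxE eq_sym (negPf (neq_lift _ _)).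
have p_gt0 i : 0 < p 0 i.
  rewrite pE; apply: mixdet_gt0; first by rewrite /= sN'.
  move=> M; rewrite !inE => /or3P[/eqP->|/eqP->|/pN' //]; exact: positive_definite1.
have LN i := IH (sN' i) (@pN' i) (positive_definite1 _).
have hN i M : M \in Ns' i -> M \is hermsymmx by move=> /pN' [].
have hD i (x : 'rV[C]_m.+3) : (forall i, x 0 i \is Num.real) ->
    minor_at i (diag_mx x) \is hermsymmx.
  by move=> /diag_mx_herm; apply: minor_at_herm.
(* Reverse Cauchy-Schwarz in each minor, between the identity and the minor of [diag_mx x], then
   summed over [i]. *)
have bochner (x : 'rV_m.+3) : (forall i, x 0 i \is Num.real) ->
    (x *m a *m x^T) 0 0 <= \sum_i (x *m a) 0 i ^+ 2 / p 0 i.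
  move=> x_real; rewrite -q_diag q_minors; apply: ler_sum => i _.
  rewrite ler_pdivlMr // mulrC -q_delta q_minor.
  have := p_gt0 i; rewrite pE => p_gt0'.
  by have [] := lorentzian_cauchy_schwarz (sN' i) (@hN i) (LN i)
    (proj1 (positive_definite1 _)) p_gt0' (hD i x x_real).
have dp : \sum_i d 0 i * p 0 i = 0.
  rewrite -[RHS]d1 qC q_diagl; apply: eq_bigr => i _.
  by rewrite q_minor minor_at1 pE.
have dC : d^t* = d^T by apply/colP => i; rewrite !mxE; apply/CrealP.
have pE' i : p 0 i = \sum_j a i j by rewrite mxE.
have [] := perron_bochner pE' sa a_ge0 a_gt0 p_gt0 bochner dp.
rewrite dC -q_diag => le0 eq0; split=> // dd0; have da := eq0 dd0.
have minor_le0 i := LN i _ (hD i d d_real).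
have orth i : mixdet [:: 1%:M, minor_at i (diag_mx d) & Ns' i] = 0.
  by rewrite -q_minor q_delta da mxE.
(* The vanishing form is a sum of nonpositive forms of minors, so each is zero; each minor being
   orthogonal to the identity, definiteness from [IH] kills it. *)
have minor0 i : minor_at i (diag_mx d) = 0.
  have [_] := minor_le0 i (orth i); apply.
  move/eqP: dd0; rewrite q_minors -oppr_eq0 -sumrN psumr_eq0 => [/allP E|j _].
    by have /eqP := E i (mem_index_enum i) => /eqP; rewrite oppr_eq0 => /eqP.
  by rewrite oppr_ge0; have [] := minor_le0 j (orth j).
apply/rowP => j; pose i := lift j ord0.
have : i != j by rewrite eq_sym neq_lift.
case: (unliftP i j) => [k jE _|->]; last by rewrite eqxx.
by have := minor0 i => /matrixP/(_ k k); rewrite !mxE eqxx -jE.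
Qed.

End Step.

(** The head [Z] of the list serves as base point: the property at [Z] transfers to [A], and
    reducing [Z] to the identity puts the identity in the third slot as well. *)
Theorem mixdet_lorentzian m (Ms : seq 'M[C]_m.+2) A : size Ms = m ->
  (forall M, M \in Ms -> positive_definite M) -> positive_definite A ->
  lorentzian_at Ms A.
Proof.
elim: m Ms A => [|m IH] [|Z Ms] A //= => [_ _|[sM] pM pA].
  exact: lorentzian_mx2.
have pZ := pM _ (mem_head Z Ms).
have hM M : M \in Z :: Ms -> M \is hermsymmx by move=> /pM [].
have gt0 B : positive_definite B -> 0 < mixdet [:: B, A, Z & Ms].
  move=> pB; apply: mixdet_gt0; first by rewrite /= sM.
  by move=> M; rewrite !in_cons => /or3P[/eqP->|/eqP->|/pM].
apply: (lorentzian_transfer _ hM _ (proj1 pA) (proj1 pZ) (gt0 _ pZ) (gt0 _ pA)).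
  by rewrite /= sM.
apply: (lorentzian_reduce pZ) => X Xu XZ d d_real /=; rewrite XZ.
apply: (lorentzian_diag (fun Ms sM pM A => IH Ms A sM pM)) => //.
  by rewrite size_map.
move=> _ /mapP [M MMs ->]; apply: (congr_mx_pd (mulmxV Xu)).
by apply: pM; rewrite inE MMs orbT.
Qed.

End MixdetLorentzian.

(** * Definite case, and passage to semidefinite matrices *)

Section SemidefiniteLimit.
Variable C : numClosedFieldType.

(** Algebraic substitute for a limit: P(e) = P(0) + e Q(e) with |Q| at most [K] on (0, 1], so a
    negative P(0) would persist for small e. *)
Lemma horner0_ge0 (P : {poly C}) : P.[0] \is Num.real ->
  (forall e, 0 < e -> 0 <= P.[e]) -> 0 <= P.[0].
Proof.
move=> P0_real P_ge0; rewrite real_leNgt ?real0 //; apply/negP => P0_lt0.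
have /factor_theorem [Q PQ] : root (P - P.[0]%:P) 0.
  by rewrite /root !hornerE subrr.
have PE e : P.[e] = P.[0] + Q.[e] * e.
  by rewrite -[P in LHS](subrK P.[0]%:P) PQ subr0 !hornerE addrC.
pose K := \sum_(i < size Q) `|Q`_i|.
have K_ge0 : 0 <= K by apply: sumr_ge0.
(* [D] exceeds both [K] and -P(0), so e = -P(0) / D satisfies e <= 1 and K e < -P(0). *)
pose D := K + 1 - P.[0].
have D_gt0 : 0 < D by rewrite subr_gt0 (lt_trans P0_lt0) // ltr_wpDl.
pose e := - P.[0] / D.
have e_gt0 : 0 < e by rewrite divr_gt0 // oppr_gt0.
have e_le1 : e <= 1.
  by rewrite ler_pdivrMr // mul1r lerDr addr_ge0.
have QK : `|Q.[e]| <= K.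
  rewrite horner_coef; apply: le_trans (ler_norm_sum _ _ _) _.
  apply: ler_sum => i _; rewrite normrM normrX (gtr0_norm e_gt0).
  by rewrite ler_piMr // exprn_ile1 // ltW.
have P0_le : - P.[0] <= Q.[e] * e by rewrite lerNl -subr_ge0 opprK -PE P_ge0.
have : - P.[0] < - P.[0].
  apply: (le_lt_trans P0_le).
  have /ger0_norm <- : 0 <= Q.[e] * e.
    by apply: le_trans P0_le; rewrite oppr_ge0 ltW.
  rewrite normrM (gtr0_norm e_gt0); apply: (@le_lt_trans _ _ (K * e)).
    by rewrite ler_pM2r.
  rewrite /e mulrA ltr_pdivrMr // mulrC ltr_pM2l ?oppr_gt0 //.
  by rewrite /D -addrA ltrDl addr_gt0 // oppr_gt0.
by rewrite ltxx.
Qed.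

Lemma pd_addr_scalar n (A : 'M[C]_n) e :
  positive_semidefinite A -> 0 < e -> positive_definite (A + e%:M).
Proof.
move=> [hA pA] e0; split=> [|x x0].
  rewrite addrC -scalemx1; apply: herm_linear => //; first exact: gtr0_real.
  by case: (positive_definite1 C n).
rewrite mulmxDr mulmxDl mxE ltr_wpDl // mul_mx_scalar -scalemxAl mxE.
rewrite mulr_gt0 // -[x^t*]mulmx1.
by case: (positive_definite1 C n) => _; apply.
Qed.

Theorem mixdet_alexandrov m (A B : 'M[C]_m.+2) Ms : size Ms = m ->
  positive_definite A -> (forall M, M \in Ms -> positive_definite M) ->
  B \is hermsymmx ->
  mixdet [:: A, A & Ms] * mixdet [:: B, B & Ms] <= mixdet [:: A, B & Ms] ^+ 2 /\
  (mixdet [:: A, B & Ms] ^+ 2 = mixdet [:: A, A & Ms] * mixdet [:: B, B & Ms] ->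
   exists2 t, t \is Num.real & B = t *: A).
Proof.
move=> sM pA pM hB; apply: lorentzian_cauchy_schwarz => //.
- by move=> M /pM [].
- exact: mixdet_lorentzian.
- by case: pA.
apply: mixdet_gt0; first by rewrite /= sM.
by move=> M; rewrite !inE => /or3P [/eqP->|/eqP->|/pM].
Qed.

(** With e times the identity added to [A] and [Ms] but not to [B], the difference of the two sides
    is a polynomial in e, nonnegative for e > 0 by the definite case. *)
Theorem mixdet_alexandrov_psd m (A B : 'M[C]_m.+2) Ms : size Ms = m ->
  positive_semidefinite A ->
  (forall M, M \in Ms -> positive_semidefinite M) -> B \is hermsymmx ->
  mixdet [:: A, A & Ms] * mixdet [:: B, B & Ms] <= mixdet [:: A, B & Ms] ^+ 2.
Proof.
move=> sM pA pM hB.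
pose Lp (M : 'M[C]_m.+2) : 'M[{poly C}]_m.+2 := map_mx polyC M + 'X%:M.
pose Bp : 'M[{poly C}]_m.+2 := map_mx polyC B.
pose P : {poly C} := mixdet [:: Lp A, Bp & map Lp Ms] ^+ 2 -
  mixdet [:: Lp A, Lp A & map Lp Ms] * mixdet [:: Bp, Bp & map Lp Ms].
pose Me e (M : 'M[C]_m.+2) := M + e%:M.
have LpE e M : map_mx (horner_eval e) (Lp M) = Me e M.
  by apply/matrixP => i j; rewrite !mxE /= horner_evalE !hornerE hornerMn hornerX.
have BpE e : map_mx (horner_eval e) Bp = B.
  by apply/matrixP => i j; rewrite !mxE /= horner_evalE hornerC.
have LMs e : map (map_mx (horner_eval e)) (map Lp Ms) = map (Me e) Ms.
  by rewrite -map_comp; apply: eq_map => M /=; apply: LpE.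
have PE e : P.[e] = mixdet [:: Me e A, B & map (Me e) Ms] ^+ 2 -
    mixdet [:: Me e A, Me e A & map (Me e) Ms] * mixdet [:: B, B & map (Me e) Ms].
  rewrite -horner_evalE rmorphB rmorphXn rmorphM !rmorph_mixdet /= LMs.
  by rewrite !LpE !BpE.
have Me0 M : Me 0 M = M by rewrite /Me raddf0 addr0.
have Me0s : map (Me 0) Ms = Ms by rewrite -[RHS]map_id; apply: eq_map.
have hM M : M \in Ms -> M \is hermsymmx by move=> /pM [].
have hA : A \is hermsymmx by case: pA.
have rE := herm_form_real hM.
have := @horner0_ge0 P; rewrite PE Me0s Me0 subr_ge0; apply.
  by rewrite rpredB ?rpredX ?rpredM // rE.
move=> e e0; rewrite PE subr_ge0.
have [] // := @mixdet_alexandrov m (Me e A) B (map (Me e) Ms).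
- by rewrite size_map.
- exact: pd_addr_scalar.
by move=> _ /mapP [M MMs ->]; apply: pd_addr_scalar => //; apply: pM.
Qed.

End SemidefiniteLimit.

(** * Return to the normalised mixed discriminant *)

Lemma mixed_discriminantE (C : numClosedFieldType) n (As : n.-tuple 'M[C]_n) :
  mixed_discriminant As = n`!%:R^-1 * mixdet As.
Proof.
congr (_ * _); apply: eq_bigr => s _; congr (\det _).
by apply/matrixP => i j; rewrite !mxE (tnth_nth 0).
Qed.

Theorem mixed_discriminant_alexandrov (C : numClosedFieldType) m
    (A B : 'M[C]_m.+2) (As : m.-tuple 'M[C]_m.+2) :
  let D X Y := mixed_discriminant [tuple of [:: X, Y & As]] in
  (positive_definite A -> (forall k : 'I_m, positive_definite (tnth As k)) ->
   B \is hermsymmx ->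
   D A A * D B B <= D A B ^+ 2 /\
   (D A B ^+ 2 = D A A * D B B <-> exists2 t, t \is Num.real & B = t *: A)) /\
  (positive_semidefinite A ->
   (forall k : 'I_m, positive_semidefinite (tnth As k)) ->
   B \is hermsymmx -> D A A * D B B <= D A B ^+ 2).
Proof.
move=> D; have c_gt0 : 0 < ((m.+2)`!%:R^-1 : C) ^+ 2.
  by rewrite exprn_gt0 // invr_gt0 ltr0n fact_gt0.
(* Both sides are quadratic in mixed discriminants, so the same positive factor (1/n!)^2 cancels. *)
rewrite /D !mixed_discriminantE /= exprMn mulrACA -expr2 ler_pM2l //.
split=> [pA pAs hB|pA pAs hB]; last first.
  apply: mixdet_alexandrov_psd => //; first exact: size_tuple.
  by move=> M /tnthP [k ->].
have pM M : M \in As -> positive_definite M by move=> /tnthP [k ->].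
have [le_AB eq_AB] := mixdet_alexandrov (size_tuple As) pA pM hB.
split=> //; split=> [/(mulfI (lt0r_neq0 c_gt0))/eq_AB //|[t _ ->]].
rewrite mixdetZ [mixdet [:: A, _ & _]]mixdet_swap ?size_tuple // mixdetZ.
by ring.
Qed.

(* The matrix size is n = m + 2, and As lists A_3, ..., A_n.  The inequality is
   in the order of R[i], where [u <= v] means that v - u is real and
   nonnegative; the mixed discriminants of Hermitian matrices are real. *)
Theorem theorem3p1 (R : realType) (m : nat) (A B : 'M[R[i]]_m.+2)
    (As : m.-tuple 'M[R[i]]_m.+2) :
  (positive_definite A -> (forall k : 'I_m, positive_definite (tnth As k)) ->
   B \is hermsymmx ->
   mixed_discriminant [tuple of [:: A, A & As]] *
     mixed_discriminant [tuple of [:: B, B & As]]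
     <= mixed_discriminant [tuple of [:: A, B & As]] ^+ 2
   /\ (mixed_discriminant [tuple of [:: A, B & As]] ^+ 2
         = mixed_discriminant [tuple of [:: A, A & As]] *
           mixed_discriminant [tuple of [:: B, B & As]]
       <-> exists lambda : R, B = lambda%:C *: A))
  /\
  (positive_semidefinite A ->
   (forall k : 'I_m, positive_semidefinite (tnth As k)) ->
   B \is hermsymmx ->
   mixed_discriminant [tuple of [:: A, A & As]] *
     mixed_discriminant [tuple of [:: B, B & As]]
     <= mixed_discriminant [tuple of [:: A, B & As]] ^+ 2).
Proof.
have [pd_case psd_case] := mixed_discriminant_alexandrov A B As.
split; last exact: psd_case.
move=> pA pAs hB; have [le_AB eq_AB] := pd_case pA pAs hB.
split; first exact: le_AB.
split=> [/eq_AB [_ /complex_realP [lambda ->] ->]|[lambda BE]].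
  by exists lambda.
apply/eq_AB; exists lambda%:C; last exact: BE.
by apply/complex_realP; exists lambda.
Qed.
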